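(* For all integers $n \geq k \geq 3$ we have $\mathrm{ar}^{\star}(n,C_k)=n+\binom{k-2}{2}-1$. Moreover, every star-colouring of $K_n$ that contains no rainbow copy of $C_k$ and uses exactly $n+\binom{k-2}{2}-1 = n-k+1+\binom{k-1}{2}$ colours has, up to renaming the colours, the following structure. The vertex set of $K_n$ is the union of disjoint sets $A,B$ of sizes $n-k+1$ and $k-1$ respectively, and there is an oriented graph $\overrightarrow{T}$ on $A\cup B$ obtained from a tournament on $A$ containing no directed cycle $\overrightarrow{C_k}$ of length $k$ by adding all possible directed edges from $A$ to $B$, such that: for each vertex $x \in A$ and each outneighbour $y \in N^+_{\overrightarrow{T}}(x)$, the edge $xy$ has colour $x$ (so distinct vertices of $A$ give distinct colours), and the pairs inside $B$ receive pairwise distinct colours, none of which is used elsewhere.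
   Context: A star-colouring of a graph $G$ is an edge-colouring of $G$ in which every colour class is a star (a copy of $K_{1,m}$ with $m\ge 1$, a single edge being allowed); equivalently, there is no monochromatic matching of size two and no monochromatic triangle. An $s$-star-colouring is a star-colouring using exactly $s$ colours. An edge-coloured graph is rainbow if all its edges have different colours. For a graph $H$, $\mathrm{ar}^{\star}(n,H)$ denotes the maximum $s\in\mathbb N$ such that there exists an $s$-star-colouring of $K_n$ without a rainbow copy of $H$. $C_k$ is the cycle with $k$ vertices. $\overrightarrow{C_k}$ is the oriented graph with vertices $v_1,\dots,v_k$ and arcs $v_i\to v_{i+1}$ (indices modulo $k$). A tournament is an orientation of a complete graph. *)

(* Defs.v *)
From mathcomp Require Import all_boot.

Set Implicit Arguments.
Unset Strict Implicit.
Unset Printing Implicit Defensive.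

Record sgraph := SGraph {
  vertex :> finType;
  adj : rel vertex;
  adj_sym : symmetric adj;
  adj_irrefl : irreflexive adj
}.
Arguments adj {s}.

(* An edge is the two-element set of its ends. *)
Definition edges (G : sgraph) : {set {set G}} :=
  [set e | [exists x : G, [exists y : G, adj x y && (e == [set x; y])]]].

Definition complete_rel (V : finType) : rel V := fun x y => x != y.

Lemma complete_rel_sym V : symmetric (@complete_rel V).
Proof. by move=> x y; rewrite /complete_rel eq_sym. Qed.

Lemma complete_rel_irrefl V : irreflexive (@complete_rel V).
Proof. by move=> x; rewrite /complete_rel eqxx. Qed.

Definition complete_graph (n : nat) : sgraph :=
  SGraph (@complete_rel_sym 'I_n) (@complete_rel_irrefl 'I_n).

(* [ordS i] is i + 1 modulo k; the conjunct [i != j] only matters for k = 1. *)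
Definition cycle_rel (k : nat) : rel 'I_k :=
  fun i j => (i != j) && ((j == ordS i) || (i == ordS j)).

Lemma cycle_rel_sym k : symmetric (@cycle_rel k).
Proof. by move=> i j; rewrite /cycle_rel eq_sym orbC. Qed.

Lemma cycle_rel_irrefl k : irreflexive (@cycle_rel k).
Proof. by move=> i; rewrite /cycle_rel eqxx. Qed.

Definition cycle_graph (k : nat) : sgraph :=
  SGraph (@cycle_rel_sym k) (@cycle_rel_irrefl k).

(* An edge-colouring of G is given by a function on all sets of vertices, of
   which only the values on [edges G] are ever used. *)
Section Colouring.
Variables (G : sgraph) (C : eqType) (c : {set G} -> C).

Definition colours : seq C := undup [seq c e | e in edges G].

Definition num_colours : nat := size colours.

Definition colour_class (a : C) : {set {set G}} := [set e in edges G | c e == a].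

Definition is_star (F : {set {set G}}) : bool :=
  [exists x : G, [exists L : {set G},
    [&& L != set0, x \notin L & F == [set [set x; y] | y in L]]]].

Definition star_colouring : bool :=
  all (fun a => is_star (colour_class a)) colours.

Definition rainbow_copy (H : sgraph) : bool :=
  [exists f : {ffun H -> G},
    [&& injectiveb f,
        [forall x : H, [forall y : H, adj x y ==> adj (f x) (f y)]]
      & dinjectiveb (fun e : {set H} => c (f @: e)) (edges H)]].

End Colouring.

Definition has_s_star_colouring (n : nat) (H : sgraph) (s : nat) : bool :=
  [exists c : {ffun {set complete_graph n} -> 'I_s},
    [&& star_colouring c, num_colours c == s & ~~ rainbow_copy c H]].

(* The bound on s loses nothing, since a colouring uses at most one colour per
   edge; fixing the colours to be 'I_s loses nothing either.  Both are checked
   by [leq_ar_star].  The value is 0 if there is no suitable colouring. *)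
Definition ar_star (n : nat) (H : sgraph) : nat :=
  \max_(s < #|edges (complete_graph n)|.+1 | has_s_star_colouring n H s) s.

Lemma edge_image (G H : sgraph) (f : {ffun H -> G}) (e : {set H}) :
  [forall x : H, [forall y : H, adj x y ==> adj (f x) (f y)]] ->
  e \in edges H -> f @: e \in edges G.
Proof.
move=> /forallP homf; rewrite !inE.
case/existsP=> x /existsP[y /andP[xy /eqP->]].
apply/existsP; exists (f x); apply/existsP; exists (f y).
by rewrite (implyP (forallP (homf x) y) xy) imsetU1 imset_set1 eqxx.
Qed.

Lemma leq_ar_star (n : nat) (H : sgraph) (C : eqType)
    (c : {set complete_graph n} -> C) :
  star_colouring c -> ~~ rainbow_copy c H -> num_colours c <= ar_star n H.
Proof.
move=> starc rainc; case Es: (num_colours c) => [//|s].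
pose G := complete_graph n.
have lt_s : s.+1 < #|edges G|.+1.
  by rewrite -Es ltnS (leq_trans (size_undup _)) // size_map -cardE.
have col_mem e : e \in edges G -> c e \in colours c.
  by move=> eG; rewrite mem_undup map_f // mem_enum.
pose num a : 'I_s.+1 := inord (index a (colours c)).
have num_inj : {in colours c &, injective num}.
  move=> a b ac bc /(congr1 val); rewrite /= !inordK -?Es ?index_mem //.
  by move=> Ei; rewrite -(nth_index a ac) Ei nth_index.
pose c' : {ffun {set G} -> 'I_s.+1} := [ffun e => num (c e)].
have c'E e e' : e \in edges G -> e' \in edges G ->
    (c' e == c' e') = (c e == c e').
  move=> eG e'G; rewrite !ffunE; apply/eqP/eqP=> [|-> //].
  by apply: num_inj; apply: col_mem.
rewrite /ar_star.
apply: (@leq_bigmax_cond _ (fun i : 'I_(#|edges G|.+1) =>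
  has_s_star_colouring n H i) (fun i => nat_of_ord i) (Ordinal lt_s)).
apply/existsP; exists c'; apply/and3P; split.
- apply/allP=> a; rewrite mem_undup => /mapP[e eE ->] {a}.
  move: eE; rewrite mem_enum => eG.
  suff -> : colour_class c' (c' e) = colour_class c (c e).
    by apply: (allP starc); apply: col_mem.
  apply/setP=> e'; rewrite !in_set; case e'G: [exists _, _] => //=.
  by apply: c'E => //; rewrite inE.
- suff /perm_size : perm_eq (colours c') (map num (colours c)).
    by rewrite size_map -/(num_colours c) Es => /eqP.
  apply: uniq_perm.
  + exact: undup_uniq.
  + by rewrite map_inj_in_uniq // undup_uniq.
  move=> a; rewrite mem_undup; apply/mapP/mapP.
    case=> e; rewrite mem_enum => eG ->; exists (c e); last by rewrite ffunE.
    exact: col_mem.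
  case=> b; rewrite mem_undup => /mapP[e eE ->] ->; exists e => //.
  by rewrite ffunE.
apply: contra rainc => /existsP[f /and3P[injf homf /dinjectiveP rainf]].
apply/existsP; exists f; rewrite injf homf; apply/dinjectiveP=> e e' eH e'H Ec.
by apply: rainf => //; apply/eqP; rewrite c'E ?edge_image // Ec.
Qed.

(* Oriented graphs on V are relations on V, [D x y] being the arc x -> y. *)
Section Oriented.
Variables (V : finType) (D : rel V).

Definition tournament_on (A : {set V}) : Prop :=
  [/\ forall x y, D x y -> (x \in A) && (y \in A),
      irreflexive D
    & {in A &, forall x y, x != y -> D x y (+) D y x}].

Definition has_directed_cycle (k : nat) : Prop :=
  exists2 f : 'I_k -> V, injective f & forall i, D (f i) (f (ordS i)).

Definition add_all_arcs (A B : {set V}) : rel V :=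
  fun x y => D x y || (x \in A) && (y \in B).

Definition out_neighbours (x : V) : {set V} := [set y | D x y].

End Oriented.

(* The injection [col] is the renaming that gives the colour called "x" in the
   mathematical description to the vertex x of A. *)
Definition extremal_structure (n k : nat) (C : eqType)
    (c : {set complete_graph n} -> C) : Prop :=
  exists (A B : {set 'I_n}) (D : rel 'I_n) (col : 'I_n -> C),
    let T := add_all_arcs D A B in
    [/\ [/\ A :|: B = [set: 'I_n], [disjoint A & B],
            #|A| = n - k + 1 & #|B| = k - 1],
        tournament_on D A /\ ~ has_directed_cycle D k,
        {in A &, injective col},
        forall x y, x \in A -> y \in out_neighbours T x ->
          c [set x; y] = col x
      & forall e e', e \in edges (complete_graph n) ->
          e' \in edges (complete_graph n) ->
          e \subset B -> c e = c e' -> e = e'].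

(* Main.v *)
Require Import Defs.
From mathcomp Require Import all_boot.
From mathcomp Require Import zify.

(** Choose for every colour a common vertex of its star, and orient every edge
    from the chosen vertex of its colour.  Edges with different tails then have
    different colours, so a directed k-cycle would be rainbow; hence, by Moon's
    theorem, no strong subtournament has k or more vertices.

    If |X| >= k, let S be the first strong component of X.  All arcs leaving a
    vertex v of S inside X have one colour.  Indeed, two outneighbours of v in
    X - v can be joined, up to transitivity, by a directed path on k - 1
    vertices of X - v, or by one on k - 2 vertices prolonged by a single
    reversed arc; closing it up at v gives a k-cycle whose edges have pairwise
    distinct tails except for the two at v, so these two agree.  Peeling off S
    thus costs at most |S| colours.  We repeat this until at most k - 1 vertices
    remain.  If fewer remain, the count is strictly below the bound; otherwise
    the vertices peeled off form A and the remaining ones form B. *)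

Set Implicit Arguments.
Unset Strict Implicit.
Unset Printing Implicit Defensive.

(** * Dominating sets, first strong components and spanning paths *)

Section Tournament.
Variables (V : finType).
Implicit Types (T : rel V) (X Y Z S Q R : {set V}) (x y z v : V).

Definition tournament T : Prop :=
  irreflexive T /\ forall x y, x != y -> T x y = ~~ T y x.

Definition dominating T X S : Prop :=
  [/\ S != set0, S \subset X & {in S & X :\: S, forall x y, T x y}].

(** In a tournament the dominating subsets of [X] form a chain; its least member is the first strong
    component of [X]. *)
Definition least_dominating T X S : Prop :=
  dominating T X S /\ forall S', dominating T X S' -> S \subset S'.

(** For tournaments this is strong connectivity of a nonempty [X]: no proper nonempty subset
    dominates the rest. *)
Definition strong T X : Prop := least_dominating T X X.

Lemma tournament_rev T : tournament T -> tournament (fun x y => T y x).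
Proof.
move=> [irr asym]; split=> [x|x y xy]; first exact: irr.
by rewrite asym // eq_sym.
Qed.

Lemma tournament_asym T x y : tournament T -> T x y -> T y x = false.
Proof.
move=> [irr asym] Txy; have xy : x != y by apply: contraTneq Txy => ->; rewrite irr.
by apply/negbTE; rewrite -asym.
Qed.

(** A point of [S :\: S'] and a point of [S' :\: S] would be joined by arcs in both directions. *)
Lemma dominating_chain T X S S' : tournament T ->
  dominating T X S -> dominating T X S' -> (S \subset S') || (S' \subset S).
Proof.
move=> tT [_ SX dS] [_ SX' dS']; apply/norP => -[/subsetPn[s sS sS'] /subsetPn[t tS' tS]].
have Tst : T s t by apply: dS; rewrite // inE tS (subsetP SX').
have : T t s by apply: dS'; rewrite // inE sS' (subsetP SX).
by rewrite (tournament_asym tT).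
Qed.

Lemma least_dominating_exists T X : tournament T -> X != set0 ->
  exists S, least_dominating T X S.
Proof.
move=> tT X0.
pose d S := [&& S != set0, S \subset X & [forall x in S, forall y in X :\: S, T x y]].
have dP S : reflect (dominating T X S) (d S).
  apply: (iffP and3P) => [] [S0 SX dS]; split=> //.
    by move=> x y xS yS; move/forall_inP/(_ x xS)/forall_inP/(_ y yS): dS.
  by apply/forall_inP=> x xS; apply/forall_inP=> y; apply: dS.
have dX : d X by apply/dP; split=> // x y _; rewrite setDv inE.
case: (arg_minnP (fun S : {set V} => #|S|) dX) => S /dP dS minS.
exists S; split=> // S' dS'; case/orP: (dominating_chain tT dS dS') => // sS'S.
suff /eqP -> : S' == S by [].
by rewrite eqEcard sS'S minS //; apply/dP.
Qed.

Lemma dominating_trans T X S S' :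
  dominating T X S -> dominating T S S' -> dominating T X S'.
Proof.
move=> [_ SX dS] [S0' SS' dS']; split=> //; first exact: subset_trans SX.
move=> x y xS'; rewrite inE => /andP[yS' yX].
have [yS|yS] := boolP (y \in S); first by apply: dS'; rewrite // inE yS'.
by apply: dS; rewrite ?inE ?yS // (subsetP SS').
Qed.

Lemma least_dominating_strong T X S : least_dominating T X S -> strong T S.
Proof.
move=> [dS minS]; split; last by move=> S' /(dominating_trans dS); apply: minS.
by case: dS => S0 _ _; split=> // x y _; rewrite setDv inE.
Qed.

(** Otherwise [Q] would dominate all of [X], hence contain [S] and with it [x]. *)
Lemma least_dominating_out T X S Q x : tournament T ->
  least_dominating T X S -> x \in S -> least_dominating T (X :\ x) Q ->
  exists2 y, y \in Q & T x y.
Proof.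
move=> tT [[_ SX _] minS] xS [[Q0 QX dQ] _].
suff /exists_inP[y yQ Txy] : [exists y in Q, T x y] by exists y.
apply: contraT => /exists_inPn noT.
have xQ : x \notin Q by apply/negP=> /(subsetP QX); rewrite !inE eqxx.
have : x \in Q.
  apply: (subsetP (minS _ _)) => //; split=> //.
    exact: subset_trans QX (subsetDl _ _).
  move=> q y qQ; rewrite inE => /andP[yQ yX]; have [->|yx] := eqVneq y x.
    rewrite (tT.2 q x) ?noT //; by apply: contraNneq xQ => <-.
  by apply: dQ; rewrite // !inE yQ yx.
by rewrite (negbTE xQ).
Qed.

(** Induction on [#|X|]: by [least_dominating_out], [x] has an arc into the first component of
    [X :\ x], where the path continues. So any vertex of the first component can be the start. *)
Lemma hamiltonian_path T X S x : tournament T -> least_dominating T X S -> x \in S ->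
  exists p, [/\ path T x p, uniq (x :: p) & x :: p =i X].
Proof.
move=> tT; elim/ltn_ind: {X}#|X| {-2}X (erefl #|X|) S x => m IH X Em S x ldS xS.
have xX : x \in X by case: ldS => -[_ /subsetP SX _] _; apply: SX.
have [Z0|Z0] := eqVneq (X :\ x) set0.
  by exists [::]; split=> // y; rewrite -(setD1K xX) Z0 setU0 mem_seq1 in_set1.
have [Q ldQ] := least_dominating_exists tT Z0.
have [y yQ Txy] := least_dominating_out tT ldS xS ldQ.
have lt : #|X :\ x| < m by rewrite -Em (cardsD1 x X) xX.
have [p [pT up pX]] := IH _ lt _ erefl _ _ ldQ yQ.
exists (y :: p); split; first by rewrite /= Txy.
  by rewrite cons_uniq up andbT pX !inE eqxx.
by move=> z; rewrite inE pX !inE; case: eqVneq => [->|].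
Qed.

(** All arcs between [Q] and [X :\: Q] go forward, so an initial part of a spanning path of [Q] from
    [x] can be followed by a final part of a spanning path of [X :\: Q] to [y]. Reversing the
    relation makes [R] the last component of [X :\: Q]. *)
Lemma path_across T X Q R x y j : tournament T ->
  dominating T X Q -> strong T Q -> x \in Q ->
  least_dominating (fun a b => T b a) (X :\: Q) R -> y \in R ->
  1 < j <= #|X| ->
  exists p, [/\ path T x p, uniq (x :: p), {subset x :: p <= X},
                (size p).+1 = j & last x p = y].
Proof.
move=> tT [Q0 QX dQ] sQ xQ ldR yR /andP[j1 jX].
have [p [pT up pQ]] := hamiltonian_path tT sQ xQ.
have [q [qT uq qR]] := hamiltonian_path (tournament_rev tT) ldR yR.
have szp : (size p).+1 = #|Q|.
  by rewrite -[LHS]/(size (x :: p)) -(card_uniqP up); apply: eq_card.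
have szq : (size q).+1 = #|X :\: Q|.
  by rewrite -[LHS]/(size (y :: q)) -(card_uniqP uq); apply: eq_card.
have szX : #|X| = #|Q| + #|X :\: Q|.
  by rewrite cardsD (setIidPr QX) subnKC // subset_leq_card.
(* [i1] and [i2] count the vertices taken on either side besides [x] and [y]; as many as possible
   come from [Q]. *)
have [i1 [i2 [l1 l2 Ej]]] : exists i1 i2, [/\ i1 <= size p, i2 <= size q & i1 + i2 + 2 = j].
  exists (minn (j - 2) (size p)), (j - 2 - minn (j - 2) (size p)).
  move: (size p) (size q) #|Q| #|_| #|X| j1 jX szp szq szX => n1 n2 n3 n4 n5.
  by clear; split; lia.
pose p1 := take i1 p; pose q1 := take i2 q.
have up1 : uniq (x :: p1) by have := take_uniq i1.+1 up.
have uq1 : uniq (y :: q1) by have := take_uniq i2.+1 uq.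
have p1Q : {subset x :: p1 <= Q}.
  by move=> z z1; rewrite -pQ; apply: (@mem_take i1.+1 _ (x :: p)).
have q1R : {subset y :: q1 <= X :\: Q}.
  by move=> z z1; rewrite -qR; apply: (@mem_take i2.+1 _ (y :: q)).
have revE : rev (y :: q1) = last y q1 :: rev (belast y q1) by rewrite lastI rev_rcons.
exists (p1 ++ rev (y :: q1)); split.
- rewrite cat_path take_path //= revE /= dQ ?p1Q ?q1R ?mem_last //=.
  rewrite rev_path; exact: take_path.
- rewrite -cat_cons cat_uniq up1 rev_uniq uq1 andbT /=.
  apply/hasPn=> z; rewrite mem_rev => /q1R; rewrite inE => /andP[zQ _].
  by apply: contra zQ; apply: p1Q.
- move=> z; rewrite -cat_cons mem_cat mem_rev => /orP[/p1Q/(subsetP QX)//|/q1R].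
  by rewrite inE => /andP[].
- by rewrite size_cat size_rev /= !size_takel // -Ej addn2 addnS.
- by rewrite last_cat rev_cons last_rcons.
Qed.

(** * Moon's theorem: cycles of all lengths in a strong tournament *)

Lemma strong_leave T X S : tournament T -> strong T X -> S != set0 -> S \proper X ->
  exists x y, [/\ x \in S, y \in X :\: S & T y x].
Proof.
move=> tT [_ minX] S0 /andP[SX nXS].
have [/exists_inP[x xS /exists_inP[y yS Tyx]]|] :=
    boolP [exists x in S, [exists y in X :\: S, T y x]].
  by exists x, y.
move=> /exists_inPn H; case/negP: nXS; apply: minX; split=> // x y xS yS.
rewrite tT.2; last by apply: contraTneq yS => <-; rewrite inE xS.
by have /exists_inPn/(_ y yS) := H x xS.
Qed.

Lemma strong_cycle3 T X : tournament T -> strong T X -> 1 < #|X| ->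
  exists s, [/\ cycle T s, uniq s, size s = 3 & {subset s <= X}].
Proof.
move=> tT sX X1; have [[X0 _ _] _] := sX; have [v vX] := set0Pn _ X0.
pose I := [set y in X | T y v].
have I0 : I != set0.
  have [||a [b [/set1P->]]] := @strong_leave T X [set v] tT sX.
  - by apply/set0Pn; exists v; rewrite inE.
  - by rewrite properEcard sub1set vX cards1.
  by rewrite inE => /andP[_ bX] Tb; apply/set0Pn; exists b; rewrite inE bX.
have IX : I \proper X.
  apply/properP; split; first by apply/subsetP=> y; rewrite inE => /andP[].
  by exists v; rewrite // inE tT.1 andbF.
(* [I] dominates [v] but not all of [X], so some arc enters it from an outneighbour of [v]. *)
have [i [o []]] := strong_leave tT sX I0 IX.
rewrite !inE => /andP[iX Tiv] /andP[+ oX] Toi; rewrite oX /= => nov.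
have ov : o != v by apply: contraTneq Toi => ->; rewrite (tournament_asym tT).
have Tvo : T v o by rewrite tT.2 // eq_sym.
exists [:: v; o; i]; split=> //=; first by rewrite Tvo Toi Tiv.
  rewrite !inE negb_or eq_sym ov andbT /=; apply/andP; split; last first.
    by apply: contraTneq Toi => ->; rewrite tT.1.
  by apply: contraTneq Tiv => <-; rewrite tT.1.
by move=> z; rewrite !inE => /or3P[] /eqP ->.
Qed.

(** The first switch from a vertex that dominates [u] to one that does not. The default [y] plays
    the vertex after the last one, so that the list can be closed to a cycle. *)
Lemma insertion_point T x y u p : ~~ T y u -> has (fun a => T a u) (x :: p) ->
  exists p1 p2, [/\ p = p1 ++ p2, T (last x p1) u & ~~ T (head y p2) u].
Proof.
move=> nTyu; elim: p x => [|z p IH] x; first by rewrite /= orbF; exists [::], [::].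
have [Tzu _|nTzu] := boolP (T z u).
  by have [|p1 [p2 [-> ? ?]]] := IH z; [rewrite /= Tzu | exists (z :: p1), p2].
rewrite [has _ _]/= => /orP[Txu|hasp]; first by exists [::], (z :: p).
by have [p1 [p2 [-> ? ?]]] := IH z hasp; exists (z :: p1), p2.
Qed.

(** [u] fits between a cycle vertex that dominates it and a successor that it dominates. *)
Lemma cycle_insert T s u : tournament T -> cycle T s -> u \notin s ->
  has (fun a => T a u) s -> ~~ all (fun a => T a u) s ->
  exists2 t, cycle T t & perm_eq t (u :: s).
Proof.
move=> tT cs us hs /allPn[b bs nTbu].
(* Rotated to start at [b], which does not dominate [u], the cycle has [b] also as the vertex
   following its last one. *)
have [i p Es] := rot_to bs.
have /insertion_point-/(_ _ nTbu)[p1 [p2 [Ep Tlu nThu]]] : has (fun a => T a u) (b :: p).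
  by rewrite -Es has_rot.
exists (b :: p1 ++ u :: p2).
  move: cs; rewrite -(rot_cycle i) Es /= Ep !rcons_cat !cat_path /= => /andP[-> /=].
  rewrite Tlu /= => cp; have Tuh : T u (head b p2).
    rewrite tT.2 //; apply: contraNneq us => ->; rewrite -(mem_rot i) Es Ep.
    by case: (p2) => [|z p3]; rewrite !inE ?eqxx // mem_cat inE eqxx !orbT.
  by case: p2 cp Tuh {Ep nThu} => [|z p2] /=; [move=> _ -> | move=> /andP[_ ->] ->].
apply: perm_trans (_ : perm_eq (u :: b :: p) (u :: s)); last by rewrite perm_cons -Es perm_rot.
by rewrite Ep; apply/permPl; apply: (perm_catCA (b :: p1) [:: u] p2).
Qed.

(** A vertex with arcs both from and to the cycle is inserted. If there is none, strength yields an
    arc [o] -> [i] from a vertex dominated by the cycle to one dominating it, and this arc makes a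
    detour. *)
Lemma strong_cycle_extend T X s : tournament T -> strong T X ->
  cycle T s -> uniq s -> {subset s <= X} -> 2 < size s < #|X| ->
  exists t, [/\ cycle T t, uniq t, size t = (size s).+1 & {subset t <= X}].
Proof.
move=> tT sX cs us sXs /andP[s3 ltsX].
have [/exists_inP[u uX /and3P[nus hs nas]]|/exists_inPn nomix] :=
  boolP [exists u in X, [&& u \notin s, has (fun a => T a u) s & ~~ all (fun a => T a u) s]].
  have [t ct pt] := cycle_insert tT cs nus hs nas.
  exists t; split=> //; first by rewrite (perm_uniq pt) /= nus.
    by rewrite (perm_size pt).
  by move=> z; rewrite (perm_mem pt) inE => /predU1P[->|/sXs].
(* Every vertex outside the cycle now dominates it or is dominated by it. *)
have all_in u a : u \in X -> u \notin s -> a \in s -> T a u -> {in s, forall b, T b u}.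
  move=> uX nus a_s Tau; apply/allP; move: (nomix u uX); rewrite nus /= negb_and negbK.
  by case/orP=> // /hasPn/(_ a a_s); rewrite Tau.
have [a [b [d [p Es]]]] : exists a b d p, s = [:: a, b, d & p].
  by case: (s) s3 => [|a [|b [|d p]]] // _; exists a, b, d, p.
have aS : a \in s by rewrite Es inE eqxx.
pose I := [set u in X | (u \notin s) && T u a].
have I0 : I != set0.
  have [||x [y [xs]]] := @strong_leave T X [set z in s] tT sX.
  - by apply/set0Pn; exists a; rewrite inE.
  - rewrite properEcard (_ : #|_| = size s) ?ltsX ?andbT; last first.
      by rewrite cardsE; apply/card_uniqP.
    by apply/subsetP=> z; rewrite inE => /sXs.
  rewrite !inE in xs * => /andP[ys yX] Tyx; apply/set0Pn; exists y; rewrite !inE yX ys /=.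
  rewrite tT.2; last by apply: contraNneq ys => ->.
  apply/negP=> /(all_in y a yX ys aS)/(_ x xs).
  by rewrite (tournament_asym tT Tyx).
have IX : I \proper X.
  apply/properP; split; first by apply/subsetP=> y; rewrite inE => /andP[].
  by exists a; rewrite ?sXs // inE aS andbF.
have [i [o []]] := strong_leave tT sX I0 IX.
rewrite !inE => /and3P[iX nis Tia] /andP[+ oX] Toi; rewrite oX /= negb_and negbK => Ho.
have in_to z : z \in s -> T i z.
  move=> zs; rewrite tT.2; last by apply: contraNneq nis => ->.
  apply/negP=> /(all_in i z iX nis zs)/(_ a aS).
  by rewrite (tournament_asym tT Tia).
have nos : o \notin s.
  by apply/negP=> /in_to; rewrite (tournament_asym tT Toi).
have Tao : T a o.
  rewrite tT.2; first by move: Ho; rewrite (negbTE nos).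
  by apply: contraNneq nos => <-.
(* The detour [a], [o], [i], [d] replaces [a], [b], [d]: one vertex is lost and two are gained. *)
exists [:: a, o, i, d & p]; split.
- by move: cs; rewrite Es /= Tao Toi in_to ?Es ?inE ?eqxx ?orbT //= => /and3P[].
- move: us nis nos; rewrite Es /= !inE !negb_or -!andbA.
  move=> /and5P[ab ad ap bd /and3P[bp dp up]] /and4P[ia ib id ip] /and4P[oa ob od op].
  rewrite ap ip op dp up ad id od [a == o]eq_sym oa [a == i]eq_sym ia /= !andbT.
  by apply: contraTneq Toi => ->; rewrite tT.1.
- by rewrite Es.
- move=> z; rewrite !inE => H; case/or4P: H => [/eqP->|/eqP->|/eqP->|/orP[/eqP->|zp]] //.
  + by apply: sXs.
  + by apply: sXs; rewrite Es !inE eqxx !orbT.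
  + by apply: sXs; rewrite Es !inE zp !orbT.
Qed.

Lemma strong_pancyclic T X k : tournament T -> strong T X -> 2 < k <= #|X| ->
  exists s, [/\ cycle T s, uniq s, size s = k & {subset s <= X}].
Proof.
move=> tT sX; elim: k => // k IH /andP[k2 kX]; have [k3|k3] := ltnP 2 k.
  have [|s [cs us sz sXs]] := IH; first by rewrite k3 ltnW.
  rewrite -sz; apply: strong_cycle_extend sX cs us sXs _ => //.
  by rewrite sz k3.
have -> : k = 2 by lia.
by apply: strong_cycle3 => //; lia.
Qed.

(** A set [S'] dominating in [X :\ y] meets [S], as otherwise there would be arcs both ways between
    them. Then [S :&: S'] dominates in the strong set [S], so it is all of [S]. *)
Lemma least_dominating_del T X S y :
  tournament T -> least_dominating T X S -> y \notin S -> least_dominating T (X :\ y) S.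
Proof.
move=> tT ldS yS; have [[S0 SX dS] _] := ldS; have [_ minS] := least_dominating_strong ldS.
have inX s : s \in S -> s \in X :\ y.
  by move=> sS; rewrite !inE (subsetP SX) // andbT; apply: contraNneq yS => <-.
split.
  split=> //; first by apply/subsetP.
  by move=> a b aS; rewrite !inE => /and3P[bS _ bX]; apply: dS; rewrite // inE bS.
move=> S' [S'0 S'X dS'].
have S'X0 s : s \in S' -> s \in X by move/(subsetP S'X); rewrite !inE => /andP[].
have : S \subset S :&: S'; last by rewrite subsetI => /andP[].
apply: minS; split; rewrite ?subsetIl //.
- apply/negP=> /eqP SS'; have [[s sS] [m mS']] := (set0Pn _ S0, set0Pn _ S'0).
  have disj a : a \in S -> a \notin S'.
    by move=> aS; apply/negP=> aS'; have := in_set0 a; rewrite -SS' inE aS aS'.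
  have mS : m \notin S by apply: contraL mS'; apply: disj.
  have Tsm : T s m by apply: dS; rewrite // inE mS S'X0.
  have : T m s by apply: dS'; rewrite // inE disj ?inX.
  by rewrite (tournament_asym tT Tsm).
- move=> a b; rewrite !inE => /andP[aS aS'] /andP[+ bS]; rewrite bS /= => bS'.
  by apply: dS'; rewrite // inE bS' inX.
Qed.

End Tournament.

(** The function 'C(t, 2) - t equals -1 at 1 and 2 and grows strictly from 2 on. With m = k - 1 this
    shows that ending with fewer than k - 1 vertices costs a colour. *)
Lemma ltn_bin2_sub m w : 0 < w < m -> 2 < m -> 'C(w, 2) + m < 'C(m, 2) + w.
Proof.
case/andP=> w0 + m3; elim: m m3 => // m IH m3; rewrite ltnS leq_eqVlt => /orP[/eqP ->|wm].
  by rewrite binS bin1; lia.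
rewrite binS bin1; have [m3'|m2] := ltnP 2 m; first by have := IH m3' wm; lia.
have [-> ->] : m = 2 /\ w = 1 by lia.
by [].
Qed.

(** * The orientation given by the centres of the colours *)

Section Colouring.
Variables (V : finType) (C : eqType) (c : {set V} -> C) (ctr : C -> V) (k : nat).
Hypothesis k3 : 2 < k.
Hypothesis ctrP : forall x y, x != y -> ctr (c [set x; y]) \in [set x; y].
Hypothesis norb : forall f : 'I_k -> V,
  injective f -> ~ injective (fun i => c [set f i; f (ordS i)]).
Implicit Types (X Y Z S Q R : {set V}) (x y z v : V).

Definition centre_rel : rel V := fun x y => (x != y) && (ctr (c [set x; y]) == x).
Local Notation T := centre_rel.
Let ec x y := c [set x; y].

Lemma ecC x y : ec x y = ec y x.
Proof. by rewrite /ec setUC. Qed.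

Lemma centre_tournament : tournament T.
Proof.
split=> [x|x y xy]; first by rewrite /T eqxx.
rewrite /T [y == x]eq_sym xy /= [[set y; x]]setUC.
have := ctrP xy; rewrite !inE => /orP[/eqP->|/eqP->]; first by rewrite eqxx xy.
by rewrite eqxx eq_sym (negbTE xy).
Qed.
Local Notation tT := centre_tournament.

Lemma centre_ec x y : T x y -> ctr (ec x y) = x.
Proof. by case/andP=> _ /eqP. Qed.

(** The list form of [norb]: the [pairmap] runs through the colours around the cycle, ending with
    the edge back to [v]. *)
Lemma no_rainbow_seq v p : uniq (v :: p) -> size (v :: p) = k ->
  ~~ uniq (pairmap ec v (rcons p v)).
Proof.
move=> up sp; apply/negP=> uc.
have lt (i : 'I_k) : i < size (v :: p) by rewrite sp.
apply: (@norb (fun i => nth v (v :: p) i)).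
  by move=> i j /eqP; rewrite nth_uniq // => /eqP/val_inj.
suff ecE (i : 'I_k) : ec (nth v (v :: p) i) (nth v (v :: p) (ordS i)) =
    nth (ec v v) (pairmap ec v (rcons p v)) i.
  move=> i j; rewrite -!/(ec _ _) !ecE => /eqP.
  rewrite nth_uniq ?size_pairmap ?size_rcons -?[(size p).+1]/(size (v :: p)) //.
  by move=> /eqP/val_inj.
rewrite (@nth_pairmap _ v) ?size_rcons //.
rewrite -rcons_cons nth_rcons lt /=; congr ec.
(* At the last index [ordS] wraps around to 0, which matches the [v] appended to [p]. *)
rewrite nth_rcons; have := lt i; rewrite /= ltnS leq_eqVlt => /orP[/eqP E|lt'].
  by rewrite E ltnn eqxx -sp /= modnn.
have : i.+1 < size (v :: p) by [].
by rewrite lt' sp => ltk; rewrite modn_small.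
Qed.

(** Distinct tails thus force distinct colours along a directed path. *)
Lemma path_centres x p : path T x p -> map ctr (pairmap ec x p) = belast x p.
Proof.
by elim: p x => //= y p IH x /andP[Txy pT]; rewrite IH // centre_ec.
Qed.

Lemma no_directed_cycle s : cycle T s -> uniq s -> size s != k.
Proof.
case: s => [|v p] /=; first by move=> _ _; rewrite eq_sym -lt0n; lia.
move=> pT up; apply/eqP=> sp; case/negP: (no_rainbow_seq up sp).
by apply: (@map_uniq _ _ ctr); rewrite path_centres // belast_rcons.
Qed.

Lemma not_strong X : k <= #|X| -> ~ strong T X.
Proof.
move=> kX sX; have [|s [cs us sz _]] := @strong_pancyclic _ _ _ k tT sX.
  by rewrite k3.
by have := no_directed_cycle cs us; rewrite sz eqxx.
Qed.

(* The cycle v -> x ... y <- v closing up a path from x to y. *)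
Lemma closed_path_mono v x p : uniq [:: v, x & p] -> (size p).+2 = k ->
  uniq (v :: map ctr (pairmap ec x p)) -> T v x -> T v (last x p) ->
  ec v x = ec v (last x p).
Proof.
move=> up sp ucp Tvx Tvy; apply/eqP; apply: contraT => neq.
case/negP: (no_rainbow_seq up sp) => /=.
rewrite -cats1 pairmap_cat /= mem_cat negb_or inE cat_uniq /= orbF andbT.
move: ucp => /= /andP[vm um].
(* Both edges at [v] have a colour with centre [v], so they cannot clash with the path, only with
   each other. *)
have cm z : T v z -> ec v z \notin pairmap ec x p.
  by move=> Tvz; apply: contra vm => /(map_f ctr); rewrite centre_ec.
by rewrite cm // [ec (last x p) v]ecC neq (map_uniq um) cm.
Qed.

(** Let [Z] be [X] without [v], and [Q] its first component. If [Z] is strong, a spanning cycle of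
    [Z] relates consecutive vertices. Otherwise paths from [Q] to the last component [L] of
    [Z :\: Q] relate the outneighbours of [v] in [Q] and [L]; those in neither are treated last. *)
Lemma dominating_sole_colour X S v : k <= #|X| -> least_dominating T X S -> v \in S ->
  exists a, forall y, y \in X -> T v y -> ec v y = a.
Proof.
move=> kX ldS vS; have [[S0 SX dS] minS] := ldS.
have nSX : ~~ (X \subset S).
  apply/negP=> XS; apply: (not_strong kX).
  by have := least_dominating_strong ldS; rewrite (_ : S = X) //; apply/eqP; rewrite eqEsubset SX.
pose Z := X :\ v.
have vX : v \in X by apply: (subsetP SX).
have kZ : k <= #|Z|.+1 by rewrite (leq_trans kX) // (cardsD1 v X) vX.
have Z1 : 1 < #|Z| by rewrite -ltnS (leq_trans k3 kZ).
have Z0 : Z != set0 by rewrite -card_gt0 ltnW.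
have [Q ldQ] := least_dominating_exists tT Z0; have [dQ minQ] := ldQ.
have sQ := least_dominating_strong ldQ.
have [x xQ Tvx] := least_dominating_out tT ldS vS ldQ.
(* If [S :\ v] is nonempty it dominates in [Z], so it contains [Q]. *)
have SvQ : S = [set v] \/ Q \subset S :\ v.
  have [S1|S1] := eqVneq (S :\ v) set0; [left|right].
    by rewrite -(setD1K vS) S1 setU0.
  apply: minQ; split=> //; first exact: setSD.
  move=> a b; rewrite !inE negb_and negbK => /andP[av aS] /andP[/orP[/eqP->|bS] /andP[bv bX]].
    by rewrite eqxx in bv.
  by apply: dS; rewrite // inE bS.
have vZ z : z \in Z -> v != z by rewrite !inE eq_sym => /andP[].
have mono_path y p : path T y p -> uniq (y :: p) -> {subset y :: p <= Z} ->
    (size p).+2 = k -> T v y -> T v (last y p) -> ec v y = ec v (last y p).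
  move=> pT up pZ sp Tvy Tvl.
  have vp : v \notin y :: p by apply/negP=> /pZ/vZ; rewrite eqxx.
  apply: closed_path_mono => //; first by rewrite cons_uniq vp.
  rewrite cons_uniq path_centres //; move: vp up; rewrite lastI mem_rcons rcons_uniq inE negb_or.
  by move=> /andP[_ ->] /andP[].
have ZP y : y \in X -> T v y -> y \in Z.
  by move=> yX Tvy; rewrite !inE yX andbT; apply: contraTneq Tvy => ->; rewrite tT.1.
have [QZ|QZ] := eqVneq Q Z.
  rewrite QZ in sQ.
  have S1 : S = [set v].
    case: SvQ => // QS; case/negP: nSX; apply/subsetP=> z zX.
    have [->|zv] := eqVneq z v; first by [].
    by have : z \in Q; [rewrite QZ !inE zv | move/(subsetP QS); rewrite inE => /andP[]].
  have Tv z : z \in Z -> T v z.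
    by rewrite !inE => /andP[zv zX]; apply: dS; rewrite ?S1 !inE ?zv.
  have [s [_ us ss sZ]] := strong_cycle3 tT sQ Z1.
  have Z3 : 2 < #|Z| by rewrite -ss -(card_uniqP us); apply/subset_leq_card/subsetP.
  (* A strong [Z] has fewer than [k] vertices, and [X] has at least [k]. *)
  have Ek : #|Z|.+1 = k.
    apply/eqP; rewrite eqn_leq kZ andbT ltnNge; apply/negP=> kZ'.
    exact: not_strong kZ' sQ.
  have [|t [ct ut st tZ]] := @strong_pancyclic _ _ _ #|Z| tT sQ; first by rewrite Z3 leqnn.
  have tE : t =i Z.
    apply/subset_cardP; first by rewrite (card_uniqP ut).
    by apply/subsetP.
  exists (ec v (nth v t 0)) => y yX Tvy.
  have : y \in t by rewrite tE ZP.
  move=> /(nthP v)[i it <-]; elim: i it => // i IH it.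
  rewrite -IH 1?ltnW //.
  (* Cut before vertex i + 1, the spanning cycle becomes a path on k - 1 vertices from vertex i + 1
     to vertex i. *)
  have rE : rot i.+1 t = nth v t i.+1 :: (drop i.+2 t ++ take i.+1 t).
    by rewrite /rot (drop_nth v it).
  have lE : last (nth v t i.+1) (drop i.+2 t ++ take i.+1 t) = nth v t i.
    by rewrite (take_nth v) 1?ltnW // last_cat last_rcons.
  rewrite -lE; apply: mono_path.
  - by move: ct; rewrite -(rot_cycle i.+1) rE /= rcons_path => /andP[].
  - by rewrite -rE rot_uniq.
  - by move=> z; rewrite -rE mem_rot; apply: tZ.
  - by rewrite -Ek -st -[size t](size_rot i.+1) rE.
  - by apply/Tv/tZ/mem_nth.
  - by rewrite lE; apply/Tv/tZ/mem_nth; apply: ltnW.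
have [Q0 sQZ dQZ] := dQ.
pose R := Z :\: Q.
have R0 : R != set0 by rewrite setD_eq0; apply: contra QZ => ZQ; rewrite eqEsubset sQZ.
have [L ldL] := least_dominating_exists (tournament_rev tT) R0.
have [[L0 LR dL] minL] := ldL; have [y0 y0L] := set0Pn _ L0.
have y0R := subsetP LR _ y0L.
have Tvy0 : T v y0.
  (* Either [S] is just [v], or [Q] lies in [S]; then [X :\: S] lies in [R] and receives all arcs
     from the rest of [R], so it contains [L]. *)
  apply: (dS) => //; case: SvQ => [->|QS].
    by move: y0R; rewrite !inE => /and3P[_ -> ->].
  apply: (subsetP (minL _ _) y0 y0L); split.
  - by rewrite setD_eq0.
  - apply/subsetP=> z; rewrite !inE => /andP[zS ->]; rewrite andbT; apply/andP; split.
      by apply: contra zS => /(subsetP QS); rewrite inE => /andP[].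
    by apply: contraNneq zS => ->.
  - move=> a b; rewrite !inE negb_and negbK => /andP[aS aX] /andP[+ /and3P[_ _ bX]].
    by rewrite bX orbF => bS; apply: dS; rewrite // inE aS.
have across y z : y \in Q -> z \in L -> T v y -> T v z -> ec v y = ec v z.
  move=> yQ zL Tvy Tvz.
  have [|p [pT up pZ sp lp]] := path_across (j := k.-1) tT dQ sQ yQ ldL zL.
    by case: (k) k3 kZ => [|[|[|]]].
  by rewrite -lp; apply: mono_path; rewrite ?lp // sp prednK // ltnW // ltnW.
exists (ec v y0) => y yX Tvy; have yZ := ZP y yX Tvy.
have [yQ|yQ] := boolP (y \in Q); first exact: across.
rewrite -(across x y0) //.
have [yL|yL] := boolP (y \in L); first by rewrite (across x y).
have xZ : x \in Z by apply: (subsetP sQZ).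
have yx : x != y by apply: contraNneq yQ => <-.
have yR : y \in R by rewrite inE yQ.
(* [path_across] gives at least two vertices, too many for k - 2 when k = 3; there the path [x], [y]
   does the job. *)
have [Ek|k4] := eqVneq k 3.
  symmetry; apply: (@mono_path x [:: y]); rewrite ?Ek //= ?inE ?yx //.
    by rewrite dQZ.
  by move=> z; rewrite !inE => /orP[] /eqP->; rewrite -?in_setD1.
have Tyy0 : T y y0 by apply: dL; rewrite // inE yL.
have dQy : dominating T (Z :\ y) Q.
  split=> //; first by rewrite subsetD1 sQZ.
  by move=> a b aQ; rewrite inE in_setD1 => /and3P[bQ _ bZ]; apply: dQZ; rewrite // inE bQ.
have ldLy : least_dominating (fun a b => T b a) ((Z :\ y) :\: Q) L.
  rewrite (_ : _ :\: Q = R :\ y).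
    exact: least_dominating_del (tournament_rev tT) ldL yL.
  by apply/setP=> z; rewrite !inE; do 2 case: (_ \in _); rewrite ?andbF ?andbT.
have [|p [pT up pZ sp lp]] := path_across (j := k.-2) tT dQy sQ xQ ldLy y0L.
  by move: kZ; rewrite (cardsD1 y Z) yZ; case: (k) k3 k4 => [|[|[|[|]]]].
have yp : y \notin x :: p by apply/negP=> /pZ; rewrite !inE eqxx.
have vp : v \notin x :: p.
  by apply/negP=> /pZ; rewrite in_setD1 => /andP[_ /vZ]; rewrite eqxx.
have := @closed_path_mono v x (rcons p y); rewrite last_rcons => -> //.
- by rewrite cons_uniq -rcons_cons mem_rcons rcons_uniq in_cons negb_or vZ // vp yp.
- by rewrite size_rcons sp; case: (k) k3 => [|[|]].
(* The last edge is traversed against its arc [y] -> [y0], so its colour has centre [y]; as [y] lies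
   off the path, the centres stay distinct. *)
rewrite -cats1 pairmap_cat map_cat path_centres //= lp ecC centre_ec // cats1.
rewrite mem_rcons rcons_uniq inE negb_or vZ //=.
move: up yp vp; rewrite lastI rcons_uniq !mem_rcons !inE !negb_or.
by move=> /andP[_ ->] /andP[_ ->] /andP[_ ->].
Qed.

(** * Counting colours by peeling off first components *)

Definition pairs X : {set {set V}} := [set e : {set V} | e \subset X & #|e| == 2].

Definition covers (l : seq C) X : Prop :=
  {in X &, forall x y, T x y -> ec x y \in l}.

Lemma covers_pairs X : covers [seq c e | e in pairs X] X.
Proof.
move=> x y xX yX /andP[xy _]; apply: map_f; rewrite mem_enum inE cards2 xy andbT.
by apply/subsetP=> z; rewrite !inE => /orP[] /eqP->.
Qed.

(** No arc enters [S] from outside, so an arc of [X] starts in [S] or lies inside [X :\: S]. *)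
Lemma covers_dominating X S col l : dominating T X S ->
  {in S & X, forall x y, T x y -> ec x y = col x} ->
  covers l (X :\: S) -> covers ([seq col x | x in S] ++ l) X.
Proof.
move=> [S0 SX dS] colS lY x y xX yX Txy; rewrite mem_cat.
have [xS|xS] := boolP (x \in S).
  by rewrite (colS x y) // map_f // mem_enum.
rewrite lY ?orbT // inE ?xS ?yX ?andbT //.
apply: contraL Txy => yS; rewrite (tournament_asym tT) //.
by apply: dS; rewrite // inE xS.
Qed.

(** The extremal structure as peeling produces it; that the colours are distinct comes later, from
    counting. *)
Definition layered X A B (col : V -> C) : Prop :=
  [/\ A :|: B = X, [disjoint A & B], #|B| = k.-1, {in A & B, forall x y, T x y}
    & {in A & X, forall x y, T x y -> ec x y = col x}].

Lemma dominating_colouring X S : k <= #|X| -> least_dominating T X S ->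
  exists col, {in S & X, forall x y, T x y -> ec x y = col x}.
Proof.
(* [ec x x] is a dummy value for a vertex without outneighbours in [X]. *)
move=> kX ldS; exists (fun x => if [pick y in X | T x y] is Some y then ec x y else ec x x).
move=> x y xS yX Txy; have [a aP] := dominating_sole_colour kX ldS xS.
case: pickP => [z /andP[zX Txz]|/(_ y)]; last by rewrite yX Txy.
by rewrite !aP.
Qed.

Lemma few_colours_or_layered X : k.-1 <= #|X| ->
  (exists l, covers l X /\ size l < #|X| - k.-1 + 'C(k.-1, 2)) \/
  (exists A B col, layered X A B col).
Proof.
elim/ltn_ind: {X}#|X| {-2}X (erefl #|X|) => m IH X Em; rewrite leq_eqVlt.
case/orP=> [/eqP kX|kX].
  (* With exactly k - 1 vertices nothing is peeled off, and [col] is arbitrary. *)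
  right; exists set0, X, (fun x => ec x x); split=> //.
  - by rewrite set0U.
  - by rewrite disjoints_subset sub0set.
  - by move=> x y; rewrite inE.
  - by move=> x y; rewrite inE.
have kX' : k <= #|X| by move: kX; rewrite prednK // ltnW // ltnW.
have X0 : X != set0 by rewrite -card_gt0; apply: leq_ltn_trans kX.
have [S ldS] := least_dominating_exists tT X0; have [[S0 SX dS] minS] := ldS.
have dX := ldS.1; have [col colS] := dominating_colouring kX' ldS.
pose Y := X :\: S.
have XSY : #|X| = #|S| + #|Y| by rewrite cardsD (setIidPr SX) subnKC // subset_leq_card.
have Y0 : 0 < #|Y|.
  rewrite card_gt0 setD_eq0; apply/negP=> XS; apply: (not_strong kX').
  by have := least_dominating_strong ldS; rewrite (_ : S = X) //; apply/eqP; rewrite eqEsubset SX.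
have sS : 0 < #|S| by rewrite card_gt0.
have [kY|kY] := leqP k.-1 #|Y|.
  have lt : #|Y| < m by rewrite -Em XSY -add1n leq_add2r.
  have [[l [lY sl]]|[A [B [col' [EY AB cB dAB colA]]]]] := IH _ lt Y erefl kY.
    left; exists ([seq col x | x in S] ++ l); split; first exact: covers_dominating.
    by rewrite size_cat size_map -cardE XSY -addnBA // -addnA ltn_add2l.
  right; exists (S :|: A), B, (fun x => if x \in S then col x else col' x).
  have inY z : (z \in A) || (z \in B) -> z \in Y by rewrite -EY inE.
  split=> //.
  - rewrite -setUA EY; apply/setP=> z; rewrite !inE.
    by case: (boolP (z \in S)) => //= /(subsetP SX) ->.
  - apply/pred0P=> z /=; rewrite inE; apply/negP=> /andP[/orP[zS|zA] zB].
      by have := inY z; rewrite zB orbT inE zS => /(_ isT).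
    by rewrite (disjointFr AB zA) in zB.
  - move=> x y xSA yB; have yY : y \in Y by apply: inY; rewrite yB orbT.
    by move: xSA; rewrite inE => /orP[xS|xA]; [apply: dS | apply: dAB].
  move=> x y; rewrite inE; have [xS _|/= nxS xA] := boolP (x \in S); first exact: colS.
  move=> yX Txy; apply: colA => //; rewrite inE yX andbT.
  apply: contraL Txy => yS; rewrite (tournament_asym tT) // dS //.
  by apply: inY; rewrite xA.
(* Fewer than k - 1 vertices remain. Even if each of their pairs has its own colour, the total falls
   short. *)
left; exists ([seq col x | x in S] ++ [seq c e | e in pairs Y]); split.
  by apply: covers_dominating => //; apply: covers_pairs.
rewrite size_cat !size_map -!cardE cards_draws.
(* [ltn_bin2_sub] is strict only from 3 on, so k = 3 is excluded first. *)
have k4 : 2 < k.-1.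
  rewrite ltnNge; apply/negP=> k_le3.
  have Ek : k = 3 by case: (k) k3 k_le3 => [|[|[|[|]]]].
  (* Now Y is a single vertex, so S is strong with at least two vertices. *)
  have S1 : 1 < #|S|.
    by move: kX' kY; rewrite Ek XSY; case: #|Y| Y0 => [|[|]] //; rewrite addn1.
  have [s [cs us ss _]] := strong_cycle3 tT (least_dominating_strong ldS) S1.
  by have := no_directed_cycle cs us; rewrite ss Ek.
have := ltn_bin2_sub _ k4 => /(_ #|Y|); rewrite Y0 kY => /(_ isT); move: kX; rewrite XSY.
move: #|S| #|Y| k.-1 'C(#|Y|, 2) 'C(k.-1, 2) => s y m' d d'; clear; lia.
Qed.

Lemma layered_covers X A B col : layered X A B col ->
  covers ([seq col x | x in A] ++ [seq c e | e in pairs B]) X.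
Proof.
move=> [EX AB cB dAB colA] x y xX yX Txy; rewrite mem_cat.
have [xA|xA] := boolP (x \in A); first by rewrite (colA x y) // map_f // mem_enum.
move: xX; rewrite -EX inE (negbTE xA) /= => xB.
have yA : y \notin A by apply: contraL Txy => yA; rewrite (tournament_asym tT) // dAB.
move: yX; rewrite -EX inE (negbTE yA) /= => yB.
by rewrite covers_pairs ?orbT.
Qed.

Lemma size_layered X A B col : layered X A B col ->
  size ([seq col x | x in A] ++ [seq c e | e in pairs B]) = #|X| - k.-1 + 'C(k.-1, 2).
Proof.
move=> [<- AB cB _ _]; rewrite size_cat !size_map -!cardE cards_draws cB.
by rewrite cardsU disjoint_setI0 // cards0 subn0 cB addnK.
Qed.

End Colouring.

(** * From oriented vertex sets back to star-colourings of complete graphs *)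

Lemma edges_completeP n (e : {set complete_graph n}) :
  reflect (exists x y : 'I_n, x != y /\ e = [set x; y]) (e \in edges (complete_graph n)).
Proof.
rewrite inE; apply: (iffP existsP) => [[x /existsP[y /andP[xy /eqP->]]]|[x [y [xy ->]]]].
  by exists x, y.
by exists x; apply/existsP; exists y; apply/andP; split=> //; apply/eqP.
Qed.

Lemma edges_cycleP k (e : {set cycle_graph k}) :
  reflect (exists2 i : 'I_k, i != ordS i & e = [set i; ordS i]) (e \in edges (cycle_graph k)).
Proof.
rewrite inE; apply: (iffP existsP) => [[x /existsP[y /andP[/andP[xy adj] /eqP->]]]|[i ii ->]].
  case/orP: adj => /eqP E; first by exists x; rewrite -E.
  by exists y; rewrite -E 1?eq_sym // setUC.
by exists i; apply/existsP; exists (ordS i); rewrite eqxx andbT; apply/andP; split; rewrite ?eqxx.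
Qed.

Lemma ordS_neq k (i : 'I_k) : 1 < k -> i != ordS i.
Proof.
move=> k1; apply/eqP=> /(congr1 val) /=; have := ltn_ord i; rewrite leq_eqVlt => /orP[/eqP E|lt].
  by rewrite E modnn => i0; rewrite -E i0 in k1.
by rewrite modn_small // => /eqP; rewrite eqn_leq ltnn andbF.
Qed.

Section StarColouring.
Variables (n k : nat) (C : eqType) (c : {set 'I_n} -> C).
Local Notation G := (complete_graph n).
Hypotheses (k3 : 2 < k) (kn : k <= n).

Lemma star_centre : @star_colouring G C c ->
  exists ctr : C -> 'I_n, forall x y : 'I_n, x != y -> ctr (c [set x; y]) \in [set x; y].
Proof.
move=> starc; have n0 : 0 < n by apply: leq_trans kn; apply: ltnW (ltnW k3).
(* The default serves colours that do not occur. For a colour that occurs the [pick] succeeds, and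
   for a single edge either end will do. *)
exists (fun a => odflt (Ordinal n0)
  [pick x : 'I_n | [forall e in @colour_class G C c a, x \in e]]).
move=> x y xy; set e := [set x; y]; have eG : e \in edges (G).
  by apply/edges_completeP; exists x, y.
have ce : c e \in @colours G C c by rewrite mem_undup map_f // mem_enum.
case: pickP => [z /forall_inP/(_ e)|none]; first by apply; rewrite inE eG eqxx.
have /existsP[z /existsP[L /and3P[_ _ /eqP cE]]] := allP starc _ ce.
have /negP[] := negbT (none z).
by apply/forall_inP=> e'; rewrite cE => /imsetP[t _ ->]; rewrite !inE eqxx.
Qed.

Lemma rainbow_cycle (f : 'I_k -> 'I_n) : injective f ->
  injective (fun i => c [set f i; f (ordS i)]) -> @rainbow_copy G C c (cycle_graph k).
Proof.
move=> injf injc; apply/existsP; exists (finfun f : {ffun cycle_graph k -> G}).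
apply/and3P; split.
- by apply/injectiveP=> i j; rewrite !ffunE; apply: injf.
- apply/forallP=> i; apply/forallP=> j; apply/implyP=> /andP[ij _].
  by rewrite !ffunE; apply: contra ij => /eqP/injf->.
have imE (i : 'I_k) : (finfun f : {ffun cycle_graph k -> G}) @: [set i; ordS i]
    = [set f i; f (ordS i)].
  by rewrite imsetU1 imset_set1 !ffunE.
apply/dinjectiveP=> e e' /edges_cycleP[i _ ->] /edges_cycleP[j _ ->].
by rewrite !imE => /injc ->.
Qed.

Lemma colours_sub_covers (ctr : C -> 'I_n) l :
  (forall x y : 'I_n, x != y -> ctr (c [set x; y]) \in [set x; y]) ->
  covers c ctr l [set: 'I_n] -> {subset @colours G C c <= l}.
Proof.
move=> ctrP lP a; rewrite mem_undup => /mapP[e + ->]; rewrite mem_enum.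
case/edges_completeP=> x [y [xy ->]]; have tT := @centre_tournament _ _ c ctr ctrP.
have [Txy|nTxy] := boolP (centre_rel c ctr x y); first exact: lP.
by rewrite setUC; apply: lP => //; rewrite tT.2 // eq_sym.
Qed.

(** The list from [layered_covers] contains every colour and has only as many entries as there are
    colours, so its entries are distinct. This makes [col] injective on [A] and the colours inside
    [B] distinct from each other and from those of [col]. *)
Lemma layered_extremal (ctr : C -> 'I_n) A B col :
  (forall x y : 'I_n, x != y -> ctr (c [set x; y]) \in [set x; y]) ->
  ~~ @rainbow_copy G C c (cycle_graph k) ->
  layered c ctr k [set: 'I_n] A B col ->
  @num_colours G C c = n - k.-1 + 'C(k.-1, 2) -> @extremal_structure n k C c.
Proof.
move=> ctrP norb lay numc; have tT := @centre_tournament _ _ c ctr ctrP.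
have [EX AB cB dAB colA] := lay; pose T := centre_rel c ctr.
have sub := @colours_sub_covers ctr _ ctrP (@layered_covers _ _ c ctr k ctrP _ _ _ _ lay).
have : uniq ([seq col x | x in A] ++ [seq c e | e in pairs B]).
  apply: leq_size_uniq (undup_uniq _) sub _.
  by rewrite (size_layered lay) cardsT card_ord -numc.
rewrite cat_uniq => /and3P[/dinjectiveP colI disj /dinjectiveP cI].
have inAB z : (z \in A) || (z \in B) by rewrite -in_setU EX inE.
exists A, B, (fun x y => [&& T x y, x \in A & y \in A]), col; split=> //.
- split=> //; last by rewrite cB subn1.
  have := cardsUI A B; rewrite EX disjoint_setI0 // cards0 addn0 cardsT card_ord cB.
  by move: #|A| => a; clear -k3 kn; lia.
- split; last first.
    (* The colours along a directed cycle have the distinct tails as centres, so the cycle would be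
       rainbow. *)
    case=> f injf Tf; case/negP: norb; apply: (rainbow_cycle injf) => i j /(congr1 ctr).
    have [/andP[/andP[_ /eqP ->] _] /andP[/andP[_ /eqP ->] _]] := (Tf i, Tf j).
    exact: injf.
  split=> [x y /and3P[_ -> ->]|x|x y xA yA xy] //; first by rewrite /T tT.1.
  by rewrite xA yA !andbT /T tT.2 // addNb addbb.
- move=> x y xA; rewrite inE => xy; apply: colA; rewrite ?inE //.
  by case/orP: xy => /andP[] // _; apply: dAB.
move=> e e' eG e'G eB cee'.
have pe (d : {set 'I_n}) : d \in edges (G) -> d \subset B -> d \in pairs B.
  by case/edges_completeP=> x [y [xy ->]] dB; rewrite inE dB cards2 xy.
have [e'B|] := boolP (e' \subset B); first by apply: cI; rewrite ?pe.
(* Arcs between [A] and [B] leave [A], so an edge not inside [B] has its tail in [A] and its colour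
   is a value of [col]. *)
have colx x y : T x y -> ~~ ([set x; y] \subset B) -> c [set x; y] = col x /\ x \in A.
  move=> Txy nB; have xA : x \in A.
    have := inAB x; case/orP=> // xB; have := inAB y; case/orP=> yAB.
      by have := tournament_asym tT (dAB _ _ yAB xB); rewrite -/T Txy.
    by case/negP: nB; apply/subsetP=> z; rewrite !inE => /orP[] /eqP->.
  by rewrite -(colA x y).
case/edges_completeP: e'G cee' => x [y [xy ->]] cee' nB.
suff [a aA Ea] : exists2 a, a \in A & c e = col a.
  case/hasP: disj; exists (c e); first by rewrite map_f // mem_enum pe.
  by rewrite /= Ea map_f // mem_enum.
have [Txy|nTxy] := boolP (T x y).
  by have [cE xA] := colx _ _ Txy nB; exists x; rewrite // cee'.
have Tyx : T y x by rewrite /T tT.2 // eq_sym.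
have [|cE yA] := colx _ _ Tyx; first by rewrite setUC.
by exists y; rewrite // cee' setUC.
Qed.

Lemma star_colouring_bound : @star_colouring G C c -> ~~ @rainbow_copy G C c (cycle_graph k) ->
  @num_colours G C c <= n - k.-1 + 'C(k.-1, 2) /\
  (@num_colours G C c = n - k.-1 + 'C(k.-1, 2) -> @extremal_structure n k C c).
Proof.
move=> starc norb; have [ctr ctrP] := star_centre starc.
have norb' (f : 'I_k -> 'I_n) : injective f -> ~ injective (fun i => c [set f i; f (ordS i)]).
  by move=> injf /(rainbow_cycle injf); apply/negP.
have bnd l : covers c ctr l [set: 'I_n] -> @num_colours G C c <= size l.
  by move=> /(@colours_sub_covers ctr _ ctrP); apply: uniq_leq_size (undup_uniq _).
have [||] := few_colours_or_layered k3 ctrP norb' (X := [set: 'I_n]).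
- by rewrite cardsT card_ord (leq_trans (leq_pred _)).
- case=> l []; rewrite cardsT card_ord => /bnd le_l lt_l; have lt := leq_ltn_trans le_l lt_l.
  by split; [exact: ltnW | move=> E; rewrite E ltnn in lt].
case=> A [B [col lay]]; split; last exact: layered_extremal lay.
have := bnd _ (@layered_covers _ _ c ctr k ctrP _ _ _ _ lay).
by rewrite (size_layered lay) cardsT card_ord.
Qed.

End StarColouring.

(** * The extremal colouring and the lower bound *)

Section LowerBound.
Variables (n k : nat).
Hypotheses (k3 : 2 < k) (kn : k <= n).

Let B := [set i : 'I_n | n - k < i].

(** This is the extremal structure with [A] ordered transitively by index. Vertex sets serve as
    colours: pairs for the edges inside [B], the singleton of the smaller end for all others. *)
Definition extremal_colouring (e : {set 'I_n}) : {set 'I_n} :=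
  if e \subset B then e else [set x in e | [forall y in e, x <= y]].
Local Notation c := extremal_colouring.
Local Notation G := (complete_graph n).

Lemma card_last_block : #|B| = k.-1.
Proof.
have -> : #|B| = count (ltn (n - k)) (iota 0 n).
  rewrite -val_enum_ord count_map -size_filter cardE enumT {1}/enum_mem; congr size.
  by apply: eq_filter => i; rewrite /= inE.
have -> : iota 0 n = iota 0 (n - k).+1 ++ iota (n - k).+1 k.-1.
  by rewrite -iotaD; congr iota; lia.
have low : ~~ has (ltn (n - k)) (iota 0 (n - k).+1).
  by rewrite -all_predC; apply/allP=> i; rewrite mem_iota /= -leqNgt.
have high : all (ltn (n - k)) (iota (n - k).+1 k.-1).
  by apply/allP=> i; rewrite mem_iota => /andP[].
rewrite count_cat; move: low; rewrite has_count -leqNgt leqn0 => /eqP ->.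
by move: high; rewrite all_count size_iota => /eqP ->.
Qed.

Lemma extremal_colourE (x y : 'I_n) : x < y ->
  c [set x; y] = if x \in B then [set x; y] else [set x].
Proof.
move=> xy; rewrite /c; have [xB|xB] := boolP (x \in B).
  rewrite ifT //; apply/subsetP=> z; rewrite !inE => /orP[] /eqP-> //; move: xB; rewrite inE //.
  by move=> /ltn_trans; apply.
rewrite ifN; last by apply: contra xB => /subsetP; apply; rewrite !inE eqxx.
apply/setP=> z; rewrite !inE; apply/andP/eqP=> [[/orP[]/eqP-> //]|->].
  by move/forall_inP/(_ x); rewrite !inE eqxx => /(_ isT); rewrite leqNgt xy.
rewrite eqxx; split=> //; apply/forall_inP=> t; rewrite !inE => /orP[]/eqP-> //.
exact: ltnW.
Qed.

(** For [x < y] the class of the edge is that edge alone if [x] is in [B], and otherwise the star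
    from [x] to all larger vertices. Cardinality keeps the two kinds of colours apart. *)
Lemma extremal_star : @star_colouring G _ c.
Proof.
apply/allP=> a; rewrite mem_undup => /mapP[e]; rewrite mem_enum => eG ->.
have edgeP e' : reflect (exists x y : 'I_n, x < y /\ e' = [set x; y]) (e' \in edges G).
  apply: (iffP (edges_completeP _)) => [[x [y [xy ->]]]|[x [y [xy ->]]]].
    have [lt|gt|/val_inj E] := ltngtP x y; [by exists x, y|by exists y, x; rewrite setUC|].
    by rewrite E eqxx in xy.
  by exists x, y; split=> //; apply: contraTneq xy => ->; rewrite ltnn.
have [x [y [xy ->]]] := edgeP _ eG.
have n2 (u v w : 'I_n) : u < v -> [set u; v] <> [set w].
  by move=> uv /(congr1 (fun A : {set 'I_n} => #|A|)) /eqP; rewrite cards2 cards1 neq_ltn uv.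
have starP (L : {set 'I_n}) : y \in L -> x \notin L ->
    (forall e', (e' \in edges G) && (c e' == c [set x; y]) =
      (e' \in [set [set x; z] | z in L])) ->
    is_star (@colour_class G _ c (c [set x; y])).
  move=> yL xL LE; apply/existsP; exists x; apply/existsP; exists L; rewrite xL.
  by apply/andP; split; [apply/set0Pn; exists y | apply/eqP/setP=> e'; rewrite -LE inE].
have [xB|xB] := boolP (x \in B).
  apply: (starP [set y]); rewrite ?set11 ?inE ?neq_ltn ?xy // => e'.
  rewrite imset_set1 in_set1; apply/andP/eqP=> [[/edgeP[u [v [uv ->]]]]|->].
    rewrite !extremal_colourE // xB; case: ifP => _ /eqP // E.
    by case: (n2 _ _ _ xy (esym E)).
  by split=> //; apply/edgeP; exists x, y.
apply: (starP [set z : 'I_n | x < z]); rewrite ?inE ?ltnn // => e'.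
apply/andP/imsetP=> [[/edgeP[u [v [uv ->]]]]|[z]].
  rewrite !extremal_colourE // (negbTE xB); case: ifP => _ /eqP E; first by case: (n2 _ _ _ uv E).
  by exists v; rewrite -(set1_inj E) ?inE.
rewrite inE => xz ->; rewrite !extremal_colourE // (negbTE xB); split=> //.
by apply/edgeP; exists x, z.
Qed.

(** [B] is too small for a k-cycle, so the smallest vertex of the cycle lies outside [B], and both
    cycle edges at it get its singleton as colour. *)
Lemma extremal_no_rainbow : ~~ @rainbow_copy G _ c (cycle_graph k).
Proof.
apply/negP=> /existsP[f /and3P[/injectiveP injf _ /dinjectiveP injc]].
have [i0 i0B] : exists i, f i \notin B.
  apply/existsP; rewrite -negb_forall; apply/negP=> /forallP fB.
  have : #|f @: 'I_k| <= #|B|.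
    by apply/subset_leq_card/subsetP=> z /imsetP[i _ ->].
  by rewrite (card_imset _ injf) card_ord card_last_block; lia.
have [i _ imin] := @arg_minnP _ i0 predT (fun i => f i : nat) isT.
have iB : f i \notin B.
  by move: i0B; rewrite !inE -!leqNgt; apply: leq_trans (imin i0 isT).
have cE (j : 'I_k) : j != i -> c (f @: [set i; j]) = [set f i].
  move=> ji; rewrite imsetU1 imset_set1 extremal_colourE ?(negbTE iB) //.
  by rewrite ltn_neqAle imin // andbT val_eqE (inj_eq injf) eq_sym.
have k1 : 1 < k by apply: ltnW.
have Si : ordS i != i by rewrite eq_sym ordS_neq.
have Pi : ord_pred i != i by have := ordS_neq (ord_pred i) k1; rewrite ord_predK.
have : [set i; ordS i] = [set i; ord_pred i].
  apply: injc; last by rewrite !cE.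
    by apply/edges_cycleP; exists i; rewrite // eq_sym.
  by apply/edges_cycleP; exists (ord_pred i); rewrite ord_predK // setUC.
move/setP/(_ (ordS i)); rewrite !inE eqxx orbT (negbTE Si) /= => /esym/eqP Ei.
(* If both neighbours of [i] coincided, [k] would divide 2. *)
have : ordS (ordS i) = i by rewrite Ei ord_predK.
move/(congr1 val); rewrite /= -addn1 modnDml addn1 => E.
have : i.+2 == i %[mod k] by rewrite E modn_small.
by rewrite eqn_mod_dvd // => [/dvdn_leq|]; lia.
Qed.

Lemma extremal_num_colours : n - k.-1 + 'C(k.-1, 2) <= @num_colours G _ c.
Proof.
have <- : size ([seq [set x] | x in ~: B] ++ enum (pairs B)) = n - k.-1 + 'C(k.-1, 2).
  by rewrite size_cat size_map -!cardE cards_draws cardsCs setCK card_ord card_last_block.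
apply: uniq_leq_size.
  rewrite cat_uniq enum_uniq map_inj_uniq ?enum_uniq ?andbT /=; last exact: set1_inj.
  apply/hasPn=> e; rewrite mem_enum inE => /andP[_ e2]; apply/mapP=> -[x _ Ee].
  by rewrite Ee cards1 in e2.
move=> a; rewrite mem_cat mem_undup => /orP[/mapP[x]|].
  (* The colour [[set x]] occurs on the edge from [x] to the last vertex, which differs from [x]
     because x <= n - k < n - 1. *)
  rewrite mem_enum !inE -leqNgt => xB ->; have n0 : n.-1 < n by lia.
  have lt : x < Ordinal n0 by rewrite /=; lia.
  apply/mapP; exists [set x; Ordinal n0]; last by rewrite extremal_colourE // inE ltnNge xB.
  rewrite mem_enum; apply/edges_completeP; exists x, (Ordinal n0); split=> //.
  by rewrite -val_eqE neq_ltn lt.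
rewrite mem_enum [_ \in pairs _]inE => /andP[aB /cards2P[x [y xy]]]; apply/mapP; exists a.
  by rewrite (mem_enum (edges G)); apply/edges_completeP; exists x, y.
by rewrite /c aB.
Qed.

End LowerBound.

Theorem theorem1p4 (n k : nat) (hk : 3 <= k) (hn : k <= n) :
  [/\ ar_star n (cycle_graph k) = n + 'C(k - 2, 2) - 1,
      n + 'C(k - 2, 2) - 1 = n - k + 1 + 'C(k - 1, 2)
    & forall (C : eqType) (c : {set complete_graph n} -> C),
        star_colouring c ->
        ~~ rainbow_copy c (cycle_graph k) ->
        num_colours c = n + 'C(k - 2, 2) - 1 ->
        extremal_structure k c].
Proof.
have binE : 'C(k.-1, 2) = 'C(k - 2, 2) + (k - 2).
  by case: k hk {hn} => [|[|[|j]]] // _; rewrite /= !subSS subn0 binS bin1.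
have bnd : n + 'C(k - 2, 2) - 1 = n - k.-1 + 'C(k.-1, 2) by rewrite binE; lia.
split.
- rewrite bnd; apply/eqP; rewrite eqn_leq; apply/andP; split.
    apply/bigmax_leqP=> s /existsP[c /and3P[starc /eqP numc norb]].
    by rewrite -[X in X <= _]numc; apply: (star_colouring_bound hk hn starc norb).1.
  apply: leq_trans (extremal_num_colours hk hn) _.
  exact: leq_ar_star (extremal_star _ _) (extremal_no_rainbow hk hn).
- by rewrite [k - 1]subn1 binE; lia.
- move=> C c starc norb; rewrite bnd; exact: (star_colouring_bound hk hn starc norb).2.
Qed.
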